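(* Let $\mathbb{B}$ be a locally idempotent complete bicategory. Any two splittings of the same 2-idempotent in $\mathbb{B}$ are equivalent, i.e. their splitting objects are equivalent objects of $\mathbb{B}$.
   Context: Conventions. $\circ$ denotes composition of 1-morphisms and horizontal composition of 2-morphisms, $\cdot$ denotes vertical composition of 2-morphisms; coherence isomorphisms are suppressed. A bicategory is locally idempotent complete if in all its Hom-categories every idempotent splits. Two objects of a bicategory are equivalent if there are 1-morphisms between them that are mutually inverse up to 2-isomorphism. 2-idempotents. A 2-idempotent $(A,p,m,\Delta)$ in a bicategory is an object $A$, a 1-morphism $p:A\to A$ and 2-morphisms $m:p\circ p\to p$, $\Delta:p\to p\circ p$ with $(\mathrm{id}_p\circ m)\cdot(\Delta\circ\mathrm{id}_p)=(m\circ\mathrm{id}_p)\cdot(\mathrm{id}_p\circ\Delta)=\Delta\cdot m$ and $m\cdot\Delta=\mathrm{id}_p$. A splitting of it consists of an object $B$ (the splitting object), 1-morphisms $f:A\to B$, $g:B\to A$, 2-morphisms $\varphi:f\circ g\to\mathrm{id}_B$, $\psi:\mathrm{id}_B\to f\circ g$ with $\varphi\cdot\psi=\mathrm{id}_{\mathrm{id}_B}$, and a 2-isomorphism $\gamma:g\circ f\to p$ such that $m=\gamma\cdot(\mathrm{id}_g\circ\varphi\circ\mathrm{id}_f)\cdot(\gamma^{-1}\circ\gamma^{-1})$ and $\Delta=(\gamma\circ\gamma)\cdot(\mathrm{id}_g\circ\psi\circ\mathrm{id}_f)\cdot\gamma^{-1}$. *)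

(* Defs.v *)
Set Implicit Arguments.
Unset Strict Implicit.
Unset Printing Implicit Defensive.

Declare Scope bicat_scope.
Delimit Scope bicat_scope with bicat.
Local Open Scope bicat_scope.

Record category := Category {
  obj :> Type;
  mor : obj -> obj -> Type;
  idm : forall x, mor x x;
  compm : forall x y z, mor y z -> mor x y -> mor x z;
  compm_idl : forall x y (s : mor x y), compm (idm y) s = s;
  compm_idr : forall x y (s : mor x y), compm s (idm x) = s;
  compm_assoc : forall w x y z (u : mor y z) (t : mor x y) (s : mor w x),
    compm u (compm t s) = compm (compm u t) s
}.

Arguments mor {c} x y.
Arguments idm {c} x.
Arguments compm {c x y z} t s.

Notation "t · s" := (compm t s) (at level 45, left associativity) : bicat_scope.

Record iso (C : category) (x y : C) := Iso {
  iso_fwd :> mor x y;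
  iso_inv : mor y x;
  iso_fwdK : iso_inv · iso_fwd = idm x;
  iso_invK : iso_fwd · iso_inv = idm y
}.

Definition idempotent_complete (C : category) : Prop :=
  forall (x : C) (e : mor x x), e · e = e ->
    exists (y : C) (r : mor x y) (s : mor y x),
      s · r = e /\ r · s = idm y.

(* 1-morphisms compose in applicative order: [comp1 g f] is "g after f". *)
Record bicategory := Bicategory {
  ob :> Type;
  Hom : ob -> ob -> category;
  id1 : forall a, Hom a a;
  comp1 : forall a b c, Hom b c -> Hom a b -> Hom a c;
  hcomp : forall a b c (g g' : Hom b c) (f f' : Hom a b),
    mor g g' -> mor f f' -> mor (comp1 g f) (comp1 g' f');
  hcomp_id : forall a b c (g : Hom b c) (f : Hom a b),
    hcomp (idm g) (idm f) = idm (comp1 g f);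
  interchange : forall a b c (g g' g'' : Hom b c) (f f' f'' : Hom a b)
      (t' : mor g' g'') (t : mor g g') (s' : mor f' f'') (s : mor f f'),
    hcomp (t' · t) (s' · s) = hcomp t' s' · hcomp t s;
  assoc : forall a b c d (h : Hom c d) (g : Hom b c) (f : Hom a b),
    iso (comp1 (comp1 h g) f) (comp1 h (comp1 g f));
  lunit : forall a b (f : Hom a b), iso (comp1 (id1 b) f) f;
  runit : forall a b (f : Hom a b), iso (comp1 f (id1 a)) f;
  assoc_nat : forall a b c d (h h' : Hom c d) (g g' : Hom b c) (f f' : Hom a b)
      (u : mor h h') (t : mor g g') (s : mor f f'),
    assoc h' g' f' · hcomp (hcomp u t) s = hcomp u (hcomp t s) · assoc h g f;
  lunit_nat : forall a b (f f' : Hom a b) (s : mor f f'),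
    lunit f' · hcomp (idm (id1 b)) s = s · lunit f;
  runit_nat : forall a b (f f' : Hom a b) (s : mor f f'),
    runit f' · hcomp s (idm (id1 a)) = s · runit f;
  pentagon : forall a b c d e
      (k : Hom d e) (h : Hom c d) (g : Hom b c) (f : Hom a b),
    assoc k h (comp1 g f) · assoc (comp1 k h) g f
    = hcomp (idm k) (assoc h g f) · assoc k (comp1 h g) f
      · hcomp (assoc k h g) (idm f);
  triangle : forall a b c (g : Hom b c) (f : Hom a b),
    hcomp (idm g) (lunit f) · assoc g (id1 b) f = hcomp (runit g) (idm f)
}.

Arguments Hom {b} a b0 : rename.
Arguments id1 {b} a : rename.
Arguments comp1 {b a b0 c} g f : rename.
Arguments hcomp {b a b0 c g g' f f'} t s : rename.
Arguments assoc {b a b0 c d} h g f : rename.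
Arguments lunit {b a b0} f : rename.
Arguments runit {b a b0} f : rename.

Notation "g ∘ f" := (comp1 g f) (at level 40, left associativity) : bicat_scope.
Notation "t ∗ s" := (hcomp t s) (at level 40, left associativity) : bicat_scope.

Definition locally_idempotent_complete (B : bicategory) : Prop :=
  forall a b : B, idempotent_complete (Hom a b).

Definition equivalent (B : bicategory) (a b : B) : Prop :=
  exists (f : Hom a b) (g : Hom b a),
    inhabited (iso (g ∘ f) (id1 a)) /\ inhabited (iso (f ∘ g) (id1 b)).

Record two_idempotent (B : bicategory) := TwoIdempotent {
  ti_ob : B;
  ti_p : Hom ti_ob ti_ob;
  ti_m : mor (ti_p ∘ ti_p) ti_p;
  ti_D : mor ti_p (ti_p ∘ ti_p);
  ti_frobl : (idm ti_p ∗ ti_m) · assoc ti_p ti_p ti_p · (ti_D ∗ idm ti_p)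
    = ti_D · ti_m;
  ti_frobr :
    (ti_m ∗ idm ti_p) · iso_inv (assoc ti_p ti_p ti_p) · (idm ti_p ∗ ti_D)
    = ti_D · ti_m;
  ti_sep : ti_m · ti_D = idm ti_p
}.

(* The coherence isomorphisms, left implicit in the informal notation, that make
   [id_g ∘ φ ∘ id_f] a 2-morphism from (g ∘ f) ∘ (g ∘ f) to g ∘ f and
   [id_g ∘ ψ ∘ id_f] one in the other direction. *)
Definition mid_counit (B : bicategory) (a b : B) (f : Hom a b) (g : Hom b a)
    (phi : mor (f ∘ g) (id1 b)) : mor ((g ∘ f) ∘ (g ∘ f)) (g ∘ f) :=
  (idm g ∗ (lunit f · (phi ∗ idm f) · iso_inv (assoc f g f)))
  · assoc g f (g ∘ f).

Definition mid_unit (B : bicategory) (a b : B) (f : Hom a b) (g : Hom b a)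
    (psi : mor (id1 b) (f ∘ g)) : mor (g ∘ f) ((g ∘ f) ∘ (g ∘ f)) :=
  iso_inv (assoc g f (g ∘ f))
  · (idm g ∗ (assoc f g f · (psi ∗ idm f) · iso_inv (lunit f))).

Record splitting (B : bicategory) (E : two_idempotent B) := Splitting {
  sp_ob : B;
  sp_f : Hom (ti_ob E) sp_ob;
  sp_g : Hom sp_ob (ti_ob E);
  sp_phi : mor (sp_f ∘ sp_g) (id1 sp_ob);
  sp_psi : mor (id1 sp_ob) (sp_f ∘ sp_g);
  sp_phi_psi : sp_phi · sp_psi = idm (id1 sp_ob);
  sp_gamma : iso (sp_g ∘ sp_f) (ti_p E);
  sp_m : ti_m E
    = sp_gamma · mid_counit sp_phi · (iso_inv sp_gamma ∗ iso_inv sp_gamma);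
  sp_D : ti_D E
    = (sp_gamma ∗ sp_gamma) · mid_unit sp_psi · iso_inv sp_gamma
}.

(* Main.v *)
(** Let (f, g, φ, ψ) and (f', g', φ', ψ') be the two splittings and
    σ : g'f' → gf the isomorphism obtained by comparing both with p.  The
    2-morphism (f'gφ)·(f'σg)·(ψ'f'g) is an idempotent on f'g; it splits through
    a 1-morphism h, which plays the role of the tensor product of f' and g over
    the monad p.  Symmetrically an idempotent on fg' splits through k.  Both hk
    and the identity split the same idempotent on f'gfg', hence are isomorphic.

    This computation is strict when 1-morphisms are replaced by the functors
    x ↦ f ∘ x between Hom-categories, in which all composites are nested to the
    right, so the associators enter only when translating the data to functors
    and when comparing the value of a transformation at x ∘ k with its
    whiskering by k. *)

Require Import Defs.
From Corelib Require Import ssreflect.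

Set Implicit Arguments.
Unset Strict Implicit.
Unset Printing Implicit Defensive.

Local Open Scope bicat_scope.

(** * Rewriting with right-nested composites, and uniqueness of split idempotents *)

Lemma whisker_eq (C : category) (x y z : C) (t : mor y z) (s : mor x y)
    (u : mor x z) : t · s = u -> forall w (r : mor w x), t · (s · r) = u · r.
Proof. by move=> <- w r; rewrite compm_assoc. Qed.

Lemma whisker_sq (C : category) (x y y' z : C) (t : mor y z) (s : mor x y)
    (t' : mor y' z) (s' : mor x y') : t · s = t' · s' ->
  forall w (r : mor w x), t · (s · r) = t' · (s' · r).
Proof. by move=> e w r; rewrite !compm_assoc e. Qed.

Lemma iso_fwd_inj (C : category) (x y z : C) (i : iso y z) (s t : mor x y) :
  i · s = i · t -> s = t.
Proof.
move=> e; rewrite -(compm_idl s) -(compm_idl t) -(iso_fwdK i).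
by rewrite -!compm_assoc e.
Qed.

Lemma iso_fwd_surj (C : category) (x y z : C) (i : iso x y) (s t : mor y z) :
  s · i = t · i -> s = t.
Proof.
move=> e; rewrite -(compm_idr s) -(compm_idr t) -(iso_invK i).
by rewrite !compm_assoc e.
Qed.

(** The isomorphism is [r' · s] with inverse [r · s']: in either composite the common idempotent
    appears in the middle and is absorbed. *)
Lemma retracts_iso (C : category) (x y w : C) (r : mor w x) (s : mor x w)
    (r' : mor w y) (s' : mor y w) :
  r · s = idm x -> r' · s' = idm y -> s · r = s' · r' -> inhabited (iso x y).
Proof.
move=> rs rs' e; split; exists (r' · s) (r · s').
- by rewrite -compm_assoc (compm_assoc s') -e -compm_assoc rs compm_idr.
- by rewrite -compm_assoc (compm_assoc s) e -compm_assoc rs' compm_idr.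
Qed.

(** * The strict computation with functors between categories *)

Record functor (C D : category) := Functor {
  fob :> C -> D;
  fmor : forall x y : C, mor x y -> mor (fob x) (fob y);
  fmor_id : forall x : C, fmor (idm x) = idm (fob x);
  fmor_comp : forall (x y z : C) (t : mor y z) (s : mor x y),
    fmor (t · s) = fmor t · fmor s
}.

Arguments fmor {C D} f {x y} s.

Lemma fmor_eq2 (C D : category) (F : functor C D) (x y z : C) (t : mor y z)
    (s : mor x y) (u : mor x z) : t · s = u -> fmor F t · fmor F s = fmor F u.
Proof. by move=> <-; rewrite fmor_comp. Qed.

Lemma fmor_sq (C D : category) (F : functor C D) (x y y' z : C) (t : mor y z)
    (s : mor x y) (t' : mor y' z) (s' : mor x y') :
  t · s = t' · s' -> fmor F t · fmor F s = fmor F t' · fmor F s'.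
Proof. by rewrite -!fmor_comp => ->. Qed.

Record separable_pair (A B : category) := SeparablePair {
  sf : functor A B;
  sg : functor B A;
  sphi : forall x : B, mor (sf (sg x)) x;
  spsi : forall x : B, mor x (sf (sg x));
  sphi_nat : forall (x y : B) (s : mor x y),
    sphi y · fmor sf (fmor sg s) = s · sphi x;
  spsi_nat : forall (x y : B) (s : mor x y),
    spsi y · s = fmor sf (fmor sg s) · spsi x;
  sphi_psi : forall x : B, sphi x · spsi x = idm x
}.

Arguments sphi {A B} _ x.
Arguments spsi {A B} _ x.

(** [sig] plays the role of σ; [sig_phi] and [sig_psi] express its compatibility with the
    multiplications gφf and the comultiplications gψf. *)
Record comparison (A B B' : category) (S : separable_pair A B)
    (T : separable_pair A B') := Comparison {
  sig :> forall a : A, mor (sg T (sf T a)) (sg S (sf S a));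
  sig_nat : forall (a b : A) (s : mor a b),
    sig b · fmor (sg T) (fmor (sf T) s) = fmor (sg S) (fmor (sf S) s) · sig a;
  sig_phi : forall a : A, sig a · fmor (sg T) (sphi T (sf T a))
    = fmor (sg S) (sphi S (sf S a))
      · (fmor (sg S) (fmor (sf S) (sig a)) · sig (sg T (sf T a)));
  sig_psi : forall a : A,
    fmor (sg S) (fmor (sf S) (sig a))
      · (sig (sg T (sf T a)) · fmor (sg T) (spsi T (sf T a)))
    = fmor (sg S) (spsi S (sf S a)) · sig a
}.

(** The component at [x] of the idempotent on f'g, with [S] supplying the unprimed data and [T] the
    primed ones. *)
Definition bridge (A B B' : category) (S : separable_pair A B)
    (T : separable_pair A B')
    (sigma : forall a : A, mor (sg T (sf T a)) (sg S (sf S a))) (x : B) :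
    mor (sf T (sg S x)) (sf T (sg S x)) :=
  fmor (sf T) (fmor (sg S) (sphi S x))
  · (fmor (sf T) (sigma (sg S x)) · spsi T (sf T (sg S x))).

Section Bridge.

Variables (A B B' : category) (S : separable_pair A B).
Variables (T : separable_pair A B') (sigma : comparison S T).

Notation f := (fmor (sf S)).
Notation g := (fmor (sg S)).
Notation f' := (fmor (sf T)).
Notation g' := (fmor (sg T)).

Lemma bridge_nat (x y : B) (s : mor x y) :
  bridge sigma y · f' (g s) = f' (g s) · bridge sigma x.
Proof.
rewrite /bridge -!compm_assoc spsi_nat.
rewrite (whisker_eq (fmor_eq2 _ (sig_nat _ _))) fmor_comp -!compm_assoc.
rewrite (whisker_eq (fmor_eq2 _ (fmor_eq2 _ (sphi_nat _ _)))).
by rewrite !fmor_comp -!compm_assoc.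
Qed.

Lemma bridge_idem (x : B) : bridge sigma x · bridge sigma x = bridge sigma x.
Proof.
rewrite {1}/bridge -!compm_assoc {1}/bridge.
rewrite (whisker_eq (spsi_nat _ _)) -!compm_assoc.
rewrite (whisker_eq (fmor_eq2 _ (sig_nat _ _))) fmor_comp -!compm_assoc.
rewrite (whisker_eq (fmor_eq2 _ (fmor_eq2 _ (sphi_nat _ _)))).
rewrite !fmor_comp -!compm_assoc.
rewrite (whisker_eq (spsi_nat _ _)) -!compm_assoc.
rewrite (whisker_eq (fmor_eq2 _ (sig_nat _ _))) fmor_comp -!compm_assoc.
have M := f_equal f' (sig_phi sigma (sg S x)).
rewrite !fmor_comp in M.
rewrite (compm_assoc (f' (g (f _)))) (compm_assoc (f' (g (sphi S (sf S _))))) -M.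
rewrite -!compm_assoc spsi_nat.
rewrite (whisker_eq (fmor_eq2 _ (fmor_eq2 _ (sphi_psi _ _)))).
by rewrite !fmor_id compm_idl.
Qed.

Variable (tau : comparison T S).
Hypothesis tauK : forall a, tau a · sigma a = idm _.
Hypothesis sigK : forall a, sigma a · tau a = idm _.

(* The right-hand side is the idempotent on f'gfg'(x) split by [x]. *)
Lemma bridge_bridge (x : B') :
  bridge sigma (sf S (sg T x)) · f' (g (bridge tau x))
  = f' (sigma (sg T x)) · (spsi T (sf T (sg T x)) · (spsi T x
    · (sphi T x · (sphi T (sf T (sg T x)) · f' (tau (sg T x)))))).
Proof.
(* By [sigK] it suffices to compare after precomposing with f'σ. This produces gψ·σ under f', which
   [sig_psi] rewrites so that a gfσ cancels the τ of [bridge tau x]. *)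
suff H : (bridge sigma (sf S (sg T x)) · f' (g (bridge tau x)))
    · f' (sigma (sg T x))
  = f' (sigma (sg T x)) · (spsi T (sf T (sg T x)) · (spsi T x
    · (sphi T x · sphi T (sf T (sg T x))))).
  rewrite -(compm_idr (_ · f' (g _))) -fmor_id -(sigK (sg T x)) fmor_comp.
  by rewrite compm_assoc H -!compm_assoc.
rewrite /bridge -!compm_assoc !fmor_comp -!compm_assoc.
rewrite (fmor_eq2 _ (eq_sym (sig_psi sigma (sg T x)))) !fmor_comp.
rewrite (whisker_eq (fmor_eq2 _ (fmor_eq2 _ (fmor_eq2 _ (tauK _))))).
rewrite !fmor_id compm_idl.
rewrite -(whisker_sq (fmor_sq _ (sig_nat sigma _))).
rewrite (whisker_sq (spsi_nat _ (f' _))).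
rewrite (whisker_sq (fmor_sq _ (sig_nat sigma _))).
have M := f_equal f' (sig_phi sigma (sg T x)).
rewrite !fmor_comp in M.
rewrite (compm_assoc (f' (g (f _)))) (compm_assoc (f' (g (sphi S (sf S _))))) -M.
rewrite -!compm_assoc; f_equal.
(* Only φ' and ψ' remain; their naturality puts the factors in order. *)
rewrite (whisker_sq (eq_sym (spsi_nat _ _))); f_equal.
rewrite (fmor_eq2 _ (fmor_eq2 _ (eq_sym (spsi_nat T (sphi T x))))) !fmor_comp.
by rewrite (whisker_sq (sphi_nat _ _)) sphi_nat.
Qed.

(** Splitting the inner and then the outer bridge makes [z] a retract of f'gfg'([x]); by
    [bridge_bridge] its idempotent is the one that [x] splits. *)
Lemma bridge_split_iso (x z : B') (y : B)
    (r : mor (sf S (sg T x)) y) (s : mor y (sf S (sg T x)))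
    (r' : mor (sf T (sg S y)) z) (s' : mor z (sf T (sg S y))) :
  s · r = bridge tau x -> r · s = idm y ->
  s' · r' = bridge sigma y -> r' · s' = idm z ->
  inhabited (iso z x).
Proof.
move=> sr rs sr' rs'.
apply: (@retracts_iso _ _ _ (sf T (sg S (sf S (sg T x))))
  (r' · f' (g r)) (f' (g s) · s')
  (sphi T x · (sphi T (sf T (sg T x)) · f' (tau (sg T x))))
  (f' (sigma (sg T x)) · (spsi T (sf T (sg T x)) · spsi T x))).
- rewrite -!compm_assoc (whisker_eq (fmor_eq2 _ (fmor_eq2 _ rs))).
  by rewrite !fmor_id compm_idl.
- rewrite -!compm_assoc (whisker_eq (fmor_eq2 _ (tauK _))) fmor_id compm_idl.
  by rewrite (whisker_eq (sphi_psi _ _)) compm_idl sphi_psi.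
- rewrite -!compm_assoc -bridge_bridge (whisker_eq sr') -sr !fmor_comp.
  by rewrite (whisker_sq (bridge_nat _)).
Qed.

End Bridge.

(** * Whiskering and coherence in a bicategory *)

Section Composition.

Variable B : bicategory.

Lemma hcomp_idl_comp (a b c : B) (g : Hom b c) (f f' f'' : Hom a b)
    (t : mor f' f'') (s : mor f f') :
  idm g ∗ (t · s) = (idm g ∗ t) · (idm g ∗ s).
Proof. by rewrite -interchange compm_idl. Qed.

Lemma hcomp_idr_comp (a b c : B) (g g' g'' : Hom b c) (f : Hom a b)
    (t : mor g' g'') (s : mor g g') :
  (t · s) ∗ idm f = (t ∗ idm f) · (s ∗ idm f).
Proof. by rewrite -interchange compm_idl. Qed.

Lemma hcomp_exchange (a b c : B) (g g' : Hom b c) (f f' : Hom a b)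
    (t : mor g g') (s : mor f f') :
  (t ∗ idm f') · (idm g ∗ s) = (idm g' ∗ s) · (t ∗ idm f).
Proof. by rewrite -!interchange !compm_idl !compm_idr. Qed.

Definition postcomp (a b y : B) (f : Hom a b) : functor (Hom y a) (Hom y b) :=
  Functor (fun x : Hom y a => hcomp_id f x)
    (fun x x' x'' (t : mor x' x'') (s : mor x x') => hcomp_idl_comp f t s).

(** Whiskering with an identity is faithful because [lunit] makes it naturally isomorphic to the
    identity functor. *)
Lemma id1_hcomp_inj (a b : B) (f f' : Hom a b) (s t : mor f f') :
  idm (id1 b) ∗ s = idm (id1 b) ∗ t -> s = t.
Proof.
by move=> e; apply: (@iso_fwd_surj _ _ _ _ (lunit f)); rewrite -!lunit_nat e.
Qed.

Definition iso_sym (C : category) (x y : C) (i : iso x y) : iso y x :=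
  Iso (iso_invK i) (iso_fwdK i).

Definition hcomp_idr_iso (a b c : B) (g g' : Hom b c) (i : iso g g')
    (f : Hom a b) : iso (g ∘ f) (g' ∘ f).
Proof.
exists (i ∗ idm f) (iso_inv i ∗ idm f).
- by rewrite -hcomp_idr_comp iso_fwdK hcomp_id.
- by rewrite -hcomp_idr_comp iso_invK hcomp_id.
Defined.

Definition hcomp_iso (a b c : B) (g g' : Hom b c) (f f' : Hom a b)
    (i : iso g g') (j : iso f f') : iso (g ∘ f) (g' ∘ f').
Proof.
exists (i ∗ j) (iso_inv i ∗ iso_inv j).
- by rewrite -interchange !iso_fwdK hcomp_id.
- by rewrite -interchange !iso_invK hcomp_id.
Defined.

Definition hcomp_idl_iso (a b c : B) (g : Hom b c) (f f' : Hom a b)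
    (i : iso f f') : iso (g ∘ f) (g ∘ f').
Proof.
exists (idm g ∗ i) (idm g ∗ iso_inv i).
- by rewrite -hcomp_idl_comp iso_fwdK hcomp_id.
- by rewrite -hcomp_idl_comp iso_invK hcomp_id.
Defined.

Definition comp_iso (C : category) (x y z : C) (j : iso y z) (i : iso x y) :
  iso x z.
Proof.
exists (j · i) (iso_inv i · iso_inv j).
- by rewrite -compm_assoc (whisker_eq (iso_fwdK _)) compm_idl iso_fwdK.
- by rewrite -compm_assoc (whisker_eq (iso_invK _)) compm_idl iso_invK.
Defined.

(* Kelly's unit coherence, which the axioms of a bicategory leave out. *)
Lemma lunit_assoc (a b c : B) (x : Hom b c) (k : Hom a b) :
  lunit (x ∘ k) · assoc (id1 c) x k = lunit x ∗ idm k.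
Proof.
(* After whiskering with the identity, the pentagon and two triangles apply. *)
apply: id1_hcomp_inj; rewrite hcomp_idl_comp.
apply: (@iso_fwd_surj _ _ _ _ (assoc (id1 c) (id1 c ∘ x) k)).
apply: (@iso_fwd_surj _ _ _ _
  (hcomp_idr_iso (assoc (id1 c) (id1 c) x) k)) => /=.
rewrite -!compm_assoc (compm_assoc (idm (id1 c) ∗ assoc _ _ _)) -pentagon.
rewrite compm_assoc triangle.
rewrite -(whisker_sq (assoc_nat _ _ _)) -hcomp_idr_comp triangle.
by rewrite -(hcomp_id x k) assoc_nat.
Qed.

(* [locked] here and below keeps rewriting with [compm_assoc] from looking for
   redexes inside these composites. *)
Definition assoc2 (a b c y z : B) (f : Hom b c) (g : Hom a b) (x : Hom y a)
    (k : Hom z y) : iso ((f ∘ (g ∘ x)) ∘ k) (f ∘ (g ∘ (x ∘ k))) :=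
  locked (comp_iso (hcomp_idl_iso f (assoc g x k)) (assoc f (g ∘ x) k)).

Lemma assoc2E (a b c y z : B) (f : Hom b c) (g : Hom a b) (x : Hom y a)
    (k : Hom z y) :
  iso_fwd (assoc2 f g x k) = (idm f ∗ assoc g x k) · assoc f (g ∘ x) k.
Proof. by rewrite /assoc2 -lock. Qed.

Lemma assoc2_assoc (a b c y z : B) (f : Hom b c) (g : Hom a b) (x : Hom y a)
    (k : Hom z y) :
  assoc2 f g x k · (assoc f g x ∗ idm k)
  = assoc f g (x ∘ k) · assoc (f ∘ g) x k.
Proof. by rewrite assoc2E pentagon. Qed.

Lemma assoc2_nat (a b c y z : B) (f : Hom b c) (g : Hom a b) (x x' : Hom y a)
    (s : mor x x') (k : Hom z y) :
  assoc2 f g x' k · ((idm f ∗ (idm g ∗ s)) ∗ idm k)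
  = (idm f ∗ (idm g ∗ (s ∗ idm k))) · assoc2 f g x k.
Proof.
rewrite !assoc2E -compm_assoc assoc_nat !compm_assoc -!hcomp_idl_comp.
by rewrite assoc_nat.
Qed.

(** * Natural transformations induced by 2-morphisms *)

Definition counit_at (a b y : B) (f : Hom a b) (g : Hom b a)
    (phi : mor (f ∘ g) (id1 b)) (x : Hom y b) : mor (f ∘ (g ∘ x)) x :=
  locked (lunit x · (phi ∗ idm x) · iso_inv (assoc f g x)).

Definition unit_at (a b y : B) (f : Hom a b) (g : Hom b a)
    (psi : mor (id1 b) (f ∘ g)) (x : Hom y b) : mor x (f ∘ (g ∘ x)) :=
  locked (assoc f g x · (psi ∗ idm x) · iso_inv (lunit x)).

Definition cell_at (a b b' c y : B) (f : Hom b c) (g : Hom a b)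
    (f' : Hom b' c) (g' : Hom a b') (t : mor (f ∘ g) (f' ∘ g')) (x : Hom y a) :
    mor (f ∘ (g ∘ x)) (f' ∘ (g' ∘ x)) :=
  locked (assoc f' g' x · (t ∗ idm x) · iso_inv (assoc f g x)).

(** Precomposing with the invertible associator removes the inverse from the definition; later
    equations are tested in this form. *)
Lemma counit_atK (a b y : B) (f : Hom a b) (g : Hom b a)
    (phi : mor (f ∘ g) (id1 b)) (x : Hom y b) :
  counit_at phi x · assoc f g x = lunit x · (phi ∗ idm x).
Proof. by rewrite /counit_at -lock -compm_assoc iso_fwdK compm_idr. Qed.

Lemma unit_atK (a b y : B) (f : Hom a b) (g : Hom b a)
    (psi : mor (id1 b) (f ∘ g)) (x : Hom y b) :
  unit_at psi x · lunit x = assoc f g x · (psi ∗ idm x).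
Proof. by rewrite /unit_at -lock -compm_assoc iso_fwdK compm_idr. Qed.

Lemma cell_atK (a b b' c y : B) (f : Hom b c) (g : Hom a b)
    (f' : Hom b' c) (g' : Hom a b') (t : mor (f ∘ g) (f' ∘ g')) (x : Hom y a) :
  cell_at t x · assoc f g x = assoc f' g' x · (t ∗ idm x).
Proof. by rewrite /cell_at -lock -compm_assoc iso_fwdK compm_idr. Qed.

Section Retraction.

Variables (a b y : B) (f : Hom a b) (g : Hom b a).
Variables (phi : mor (f ∘ g) (id1 b)) (psi : mor (id1 b) (f ∘ g)).

Lemma counit_at_nat (x x' : Hom y b) (s : mor x x') :
  counit_at phi x' · (idm f ∗ (idm g ∗ s)) = s · counit_at phi x.
Proof.
apply: (@iso_fwd_surj _ _ _ _ (assoc f g x)).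
rewrite -!compm_assoc counit_atK -assoc_nat hcomp_id.
rewrite (whisker_eq (counit_atK _ _)) -!compm_assoc hcomp_exchange.
by rewrite (whisker_sq (lunit_nat _)).
Qed.

Lemma unit_at_nat (x x' : Hom y b) (s : mor x x') :
  unit_at psi x' · s = (idm f ∗ (idm g ∗ s)) · unit_at psi x.
Proof.
apply: (@iso_fwd_surj _ _ _ _ (lunit x)).
rewrite -!compm_assoc unit_atK -lunit_nat.
rewrite (whisker_eq (unit_atK _ _)) -!compm_assoc hcomp_exchange.
by rewrite -(whisker_sq (assoc_nat _ _ _)) hcomp_id.
Qed.

Lemma counit_at_unit_at (x : Hom y b) :
  phi · psi = idm (id1 b) -> counit_at phi x · unit_at psi x = idm x.
Proof.
move=> e; apply: (@iso_fwd_surj _ _ _ _ (lunit x)).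
rewrite -compm_assoc unit_atK (whisker_eq (counit_atK _ _)) -compm_assoc.
by rewrite -hcomp_idr_comp e hcomp_id compm_idl compm_idr.
Qed.

(** The associators are compared by the pentagon, the two left unitors by [lunit_assoc]. *)
Lemma counit_at_comp (z : B) (x : Hom y b) (k : Hom z y) :
  counit_at phi (x ∘ k) · assoc2 f g x k = counit_at phi x ∗ idm k.
Proof.
apply: (@iso_fwd_surj _ _ _ _ (hcomp_idr_iso (assoc f g x) k)).
rewrite -compm_assoc assoc2_assoc /= -hcomp_idr_comp counit_atK.
rewrite (whisker_eq (counit_atK _ _)) -compm_assoc -hcomp_id -assoc_nat.
by rewrite compm_assoc lunit_assoc hcomp_idr_comp.
Qed.

Lemma unit_at_comp (z : B) (x : Hom y b) (k : Hom z y) :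
  assoc2 f g x k · (unit_at psi x ∗ idm k) = unit_at psi (x ∘ k).
Proof.
apply: (@iso_fwd_surj _ _ _ _ (hcomp_idr_iso (lunit x) k)).
rewrite -compm_assoc /= -hcomp_idr_comp unit_atK hcomp_idr_comp.
rewrite (whisker_sq (assoc2_assoc _ _ _ _)) -lunit_assoc.
rewrite (whisker_eq (unit_atK _ _)) -compm_assoc.
by rewrite assoc_nat hcomp_id.
Qed.

End Retraction.

Lemma cell_at_nat (a b b' c y : B) (f : Hom b c) (g : Hom a b)
    (f' : Hom b' c) (g' : Hom a b') (t : mor (f ∘ g) (f' ∘ g'))
    (x x' : Hom y a) (s : mor x x') :
  cell_at t x' · (idm f ∗ (idm g ∗ s)) = (idm f' ∗ (idm g' ∗ s)) · cell_at t x.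
Proof.
apply: (@iso_fwd_surj _ _ _ _ (assoc f g x)).
rewrite -!compm_assoc cell_atK -assoc_nat hcomp_id.
rewrite (whisker_eq (cell_atK _ _)) -!compm_assoc hcomp_exchange.
by rewrite -(whisker_sq (assoc_nat _ _ _)) hcomp_id.
Qed.

Lemma cell_at_comp (a b b' c y z : B) (f : Hom b c) (g : Hom a b)
    (f' : Hom b' c) (g' : Hom a b') (t : mor (f ∘ g) (f' ∘ g'))
    (x : Hom y a) (k : Hom z y) :
  assoc2 f' g' x k · (cell_at t x ∗ idm k)
  = cell_at t (x ∘ k) · assoc2 f g x k.
Proof.
apply: (@iso_fwd_surj _ _ _ _ (hcomp_idr_iso (assoc f g x) k)).
rewrite -!compm_assoc /= -hcomp_idr_comp cell_atK hcomp_idr_comp assoc2_assoc.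
rewrite (whisker_sq (assoc2_assoc _ _ _ _)) (whisker_eq (cell_atK _ _)).
by rewrite -compm_assoc assoc_nat hcomp_id.
Qed.

(** The variant of [cell_at_comp] suited to the factor f'σg of a bridge: [x ∘ k] sits one level
    deeper, under [i], and naturality of the cell absorbs the extra [assoc i x k]. *)
Lemma cell_at_comp2 (a b b' c d y z : B) (f : Hom a b) (g : Hom b c)
    (f' : Hom a b') (g' : Hom b' c) (t : mor (g' ∘ f') (g ∘ f))
    (i : Hom d a) (x : Hom y d) (k : Hom z y) :
  (idm g ∗ assoc2 f i x k)
    · (assoc g (f ∘ (i ∘ x)) k · (cell_at t (i ∘ x) ∗ idm k))
  = cell_at t (i ∘ (x ∘ k))
    · ((idm g' ∗ assoc2 f' i x k) · assoc g' (f' ∘ (i ∘ x)) k).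
Proof.
have e := cell_at_comp t (i ∘ x) k; rewrite !assoc2E -!compm_assoc in e.
rewrite !assoc2E !hcomp_idl_comp -!compm_assoc e.
by rewrite (whisker_sq (cell_at_nat _ _)).
Qed.

Lemma cell_at_cancel (a b b' c y : B) (f : Hom b c) (g : Hom a b)
    (f' : Hom b' c) (g' : Hom a b') (t : mor (f ∘ g) (f' ∘ g'))
    (u : mor (f' ∘ g') (f ∘ g)) (x : Hom y a) :
  u · t = idm (f ∘ g) -> cell_at u x · cell_at t x = idm (f ∘ (g ∘ x)).
Proof.
move=> e; apply: (@iso_fwd_surj _ _ _ _ (assoc f g x)).
rewrite -compm_assoc cell_atK (whisker_eq (cell_atK _ _)) -compm_assoc.
by rewrite -hcomp_idr_comp e hcomp_id compm_idl compm_idr.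
Qed.

(** * Multiplication and comultiplication as transformations *)

Section Middle.

Variables (a b y : B) (f : Hom a b) (g : Hom b a) (x : Hom y a).

Definition assoc4 : iso (((g ∘ f) ∘ (g ∘ f)) ∘ x) (g ∘ (f ∘ (g ∘ (f ∘ x)))) :=
  locked (comp_iso (hcomp_idl_iso g (hcomp_idl_iso f (assoc g f x)))
    (comp_iso (assoc g f ((g ∘ f) ∘ x)) (assoc (g ∘ f) (g ∘ f) x))).

Lemma assoc4E : iso_fwd assoc4 =
  (idm g ∗ (idm f ∗ assoc g f x))
  · (assoc g f ((g ∘ f) ∘ x) · assoc (g ∘ f) (g ∘ f) x).
Proof. by rewrite /assoc4 -lock. Qed.

Lemma mid_counit_at (phi : mor (f ∘ g) (id1 b)) :
  assoc g f x · (mid_counit phi ∗ idm x)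
  = (idm g ∗ counit_at phi (f ∘ x)) · assoc4.
Proof.
(* The middle factor of [mid_counit] is [counit_at phi f]; locking it lets it be folded, so that
   [counit_at_comp] applies. *)
rewrite /mid_counit [lunit _ · _ · _]lock -/(counit_at phi f) hcomp_idr_comp.
rewrite (whisker_sq (assoc_nat _ _ _)) assoc4E pentagon -counit_at_comp assoc2E.
by rewrite !hcomp_idl_comp -!compm_assoc.
Qed.

Lemma mid_unit_at (psi : mor (id1 b) (f ∘ g)) :
  assoc4 · (mid_unit psi ∗ idm x)
  = (idm g ∗ unit_at psi (f ∘ x)) · assoc g f x.
Proof.
rewrite /mid_unit [assoc _ _ _ · _ · _]lock -/(unit_at psi f) hcomp_idr_comp.
rewrite assoc4E pentagon -unit_at_comp assoc2E -!compm_assoc.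
rewrite (compm_assoc (assoc g f (g ∘ f) ∗ _)) -hcomp_idr_comp iso_invK hcomp_id.
by rewrite compm_idl assoc_nat !hcomp_idl_comp -!compm_assoc.
Qed.

End Middle.

(** Interchange performs the two copies of [t] one after the other, and each becomes a cell at its
    own depth. *)
Lemma assoc4_nat (a b b' y : B) (f : Hom a b) (g : Hom b a)
    (f' : Hom a b') (g' : Hom b' a) (t : mor (g ∘ f) (g' ∘ f')) (x : Hom y a) :
  assoc4 f' g' x · ((t ∗ t) ∗ idm x)
  = (idm g' ∗ (idm f' ∗ cell_at t x))
    · (cell_at t (g ∘ (f ∘ x)) · assoc4 f g x).
Proof.
rewrite !assoc4E -!compm_assoc assoc_nat.
have -> : t ∗ (t ∗ idm x) = (idm (g' ∘ f') ∗ (t ∗ idm x)) · (t ∗ idm _).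
  by rewrite -interchange compm_idl compm_idr.
rewrite -hcomp_id -!compm_assoc (whisker_sq (assoc_nat _ _ _)).
rewrite (compm_assoc (assoc _ _ _)) -cell_atK.
rewrite (compm_assoc (idm g' ∗ (idm f' ∗ assoc _ _ _))) -!hcomp_idl_comp.
rewrite -cell_atK !hcomp_idl_comp -!compm_assoc.
by rewrite (whisker_sq (cell_at_nat _ _)).
Qed.

Section Comparison.

Variables (a b b' y : B) (f : Hom a b) (g : Hom b a).
Variables (f' : Hom a b') (g' : Hom b' a) (t : mor (g' ∘ f') (g ∘ f)).
Variable x : Hom y a.

(** Whiskering the hypothesis with [x] and passing through [assoc4] yields the condition [sig_phi];
    [cell_at_unit] does the same for [sig_psi]. *)
Lemma cell_at_counit (phi : mor (f ∘ g) (id1 b)) (phi' : mor (f' ∘ g') (id1 b')) :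
  t · mid_counit phi' = mid_counit phi · (t ∗ t) ->
  cell_at t x · (idm g' ∗ counit_at phi' (f' ∘ x))
  = (idm g ∗ counit_at phi (f ∘ x))
    · ((idm g ∗ (idm f ∗ cell_at t x)) · cell_at t (g' ∘ (f' ∘ x))).
Proof.
move=> e; apply: (@iso_fwd_surj _ _ _ _ (assoc4 f' g' x)).
rewrite -!compm_assoc -mid_counit_at (whisker_sq (cell_atK _ _)).
rewrite -assoc4_nat -hcomp_idr_comp e hcomp_idr_comp.
by rewrite (whisker_sq (mid_counit_at _ _)).
Qed.

Lemma cell_at_unit (psi : mor (id1 b) (f ∘ g)) (psi' : mor (id1 b') (f' ∘ g')) :
  (t ∗ t) · mid_unit psi' = mid_unit psi · t ->
  (idm g ∗ (idm f ∗ cell_at t x))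
    · (cell_at t (g' ∘ (f' ∘ x)) · (idm g' ∗ unit_at psi' (f' ∘ x)))
  = (idm g ∗ unit_at psi (f ∘ x)) · cell_at t x.
Proof.
move=> e; apply: (@iso_fwd_surj _ _ _ _ (assoc g' f' x)).
rewrite -!compm_assoc cell_atK -mid_unit_at.
rewrite (compm_assoc (cell_at _ _)) (compm_assoc (idm g ∗ _)) -assoc4_nat.
rewrite -compm_assoc -hcomp_idr_comp e hcomp_idr_comp.
by rewrite (whisker_sq (mid_unit_at _ _)).
Qed.

End Comparison.

End Composition.

(** * Comparing two splittings of a 2-idempotent *)

Section Splittings.

Variables (B : bicategory) (E : two_idempotent B).

Definition splitting_pair (S : splitting E) (y : B) :
    separable_pair (Hom y (ti_ob E)) (Hom y (sp_ob S)) :=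
  @SeparablePair _ _ (postcomp y (sp_f S)) (postcomp y (sp_g S))
    (counit_at (sp_phi S) (y := y)) (unit_at (sp_psi S) (y := y))
    (counit_at_nat (sp_phi S) (y := y)) (unit_at_nat (sp_psi S) (y := y))
    (fun x => counit_at_unit_at x (sp_phi_psi S)).

(** This is σ; its inverse is [change T S]. *)
Definition change (S T : splitting E) :
    mor (sp_g T ∘ sp_f T) (sp_g S ∘ sp_f S) :=
  iso_inv (sp_gamma S) · sp_gamma T.

Lemma changeK (S T : splitting E) : change S T · change T S = idm _.
Proof.
rewrite /change -compm_assoc (whisker_eq (iso_invK _)) compm_idl.
exact: iso_fwdK.
Qed.

(** [sp_m] expresses the same [ti_m E] through both splittings; cancelling the invertible γ leaves
    the claim. *)
Lemma change_counit (S T : splitting E) :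
  change S T · mid_counit (sp_phi T)
  = mid_counit (sp_phi S) · (change S T ∗ change S T).
Proof.
rewrite /change interchange; move: (sp_m S) (sp_m T).
move: (mid_counit (sp_phi S)) (mid_counit (sp_phi T)) => mS mT -> e.
apply: (@iso_fwd_inj _ _ _ _ (sp_gamma S)).
apply: (@iso_fwd_surj _ _ _ _ (iso_sym (hcomp_iso (sp_gamma T) (sp_gamma T)))).
rewrite /= -!compm_assoc (whisker_eq (iso_invK _)) compm_idl compm_assoc -e.
by rewrite -interchange iso_invK hcomp_id compm_idr compm_assoc.
Qed.

Lemma change_unit (S T : splitting E) :
  (change S T ∗ change S T) · mid_unit (sp_psi T)
  = mid_unit (sp_psi S) · change S T.
Proof.
rewrite /change interchange; move: (sp_D S) (sp_D T).
move: (mid_unit (sp_psi S)) (mid_unit (sp_psi T)) => mS mT -> e.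
apply: (@iso_fwd_inj _ _ _ _ (hcomp_iso (sp_gamma S) (sp_gamma S))).
apply: (@iso_fwd_surj _ _ _ _ (iso_sym (sp_gamma T))).
rewrite /= -!compm_assoc iso_invK compm_idr.
rewrite (compm_assoc (sp_gamma S ∗ _)) -interchange iso_invK hcomp_id compm_idl.
by rewrite !compm_assoc -e.
Qed.

Definition splitting_comparison (S T : splitting E) (y : B) :
    comparison (splitting_pair S y) (splitting_pair T y) :=
  @Comparison _ _ _ (splitting_pair S y) (splitting_pair T y)
    (cell_at (change S T) (y := y)) (cell_at_nat (change S T) (y := y))
    (fun x => cell_at_counit x (change_counit S T))
    (fun x => cell_at_unit x (change_unit S T)).

Notation splitting_bridge S T x := (bridge (splitting_comparison S T _) x).

(** Each of the three factors of a bridge commutes with whiskering up to reassociation. Hence the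
    bridge at an identity determines all the others. *)
Lemma bridge_comp (S T : splitting E) (y z : B) (x : Hom y (sp_ob S))
    (k : Hom z y) :
  assoc2 (sp_f T) (sp_g S) x k · (splitting_bridge S T x ∗ idm k)
  = splitting_bridge S T (x ∘ k) · assoc2 (sp_f T) (sp_g S) x k.
Proof.
rewrite /bridge /= !hcomp_idr_comp (whisker_sq (assoc2_nat _ _ _ _)).
rewrite -counit_at_comp (assoc2E _ _ (_ ∘ _)) -!compm_assoc.
rewrite (whisker_sq (assoc_nat _ _ _)) !hcomp_idl_comp -!compm_assoc.
have e := f_equal (fun t => idm (sp_f T) ∗ t)
  (cell_at_comp2 (change S T) (sp_g S) x k).
rewrite /= !hcomp_idl_comp in e.
rewrite (compm_assoc (idm (sp_f T) ∗ assoc _ _ _)).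
rewrite (compm_assoc (idm (sp_f T) ∗ (idm _ ∗ assoc2 _ _ _ _))) e.
have u := unit_at_comp (sp_psi T) (sp_f T ∘ (sp_g S ∘ x)) k.
rewrite assoc2E -compm_assoc in u.
by rewrite -!compm_assoc u -unit_at_nat.
Qed.

(** Whiskering the splitting through [h] by [k] splits the bridge at [k] through [h ∘ k], so
    [bridge_split_iso] applies with [x] the identity and [y := k]. *)
Lemma bridge_split_comp (S T : splitting E)
    (h : Hom (sp_ob S) (sp_ob T)) (k : Hom (sp_ob T) (sp_ob S))
    (r : mor (sp_f T ∘ (sp_g S ∘ id1 (sp_ob S))) h)
    (s : mor h (sp_f T ∘ (sp_g S ∘ id1 (sp_ob S))))
    (r' : mor (sp_f S ∘ (sp_g T ∘ id1 (sp_ob T))) k)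
    (s' : mor k (sp_f S ∘ (sp_g T ∘ id1 (sp_ob T)))) :
  s · r = splitting_bridge S T (id1 _) -> r · s = idm h ->
  s' · r' = splitting_bridge T S (id1 _) -> r' · s' = idm k ->
  inhabited (iso (h ∘ k) (id1 (sp_ob T))).
Proof.
move=> sr rs sr' rs'.
(* [U] reassociates and then removes the identity at which the bridge was split. *)
pose U := comp_iso
  (hcomp_idl_iso (sp_f T) (hcomp_idl_iso (sp_g S) (lunit k)))
  (assoc2 (sp_f T) (sp_g S) (id1 _) k).
have UE : iso_fwd U = (idm (sp_f T) ∗ (idm (sp_g S) ∗ lunit k))
  · assoc2 (sp_f T) (sp_g S) (id1 _) k by [].
clearbody U.
have bridgeU : U · (splitting_bridge S T (id1 _) ∗ idm k)
    = splitting_bridge S T k · U.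
  rewrite UE -compm_assoc bridge_comp.
  apply: whisker_sq.
  exact: eq_sym (bridge_nat (splitting_comparison S T _) (lunit k)).
apply: (bridge_split_iso (sigma := splitting_comparison S T (sp_ob T))
  (tau := splitting_comparison T S (sp_ob T)) _ _
  (r' := (r ∗ idm k) · iso_inv U) (s' := U · (s ∗ idm k)) sr' rs').
- by move=> a; apply: cell_at_cancel; apply: changeK.
- by move=> a; apply: cell_at_cancel; apply: changeK.
- rewrite -compm_assoc (compm_assoc (s ∗ _)) -hcomp_idr_comp sr compm_assoc.
  by rewrite bridgeU -compm_assoc iso_invK compm_idr.
- rewrite -compm_assoc (whisker_eq (iso_fwdK U)) compm_idl -hcomp_idr_comp rs.
  exact: hcomp_id.
Qed.

End Splittings.

Theorem corollary4p10 (B : bicategory) (HB : locally_idempotent_complete B)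
    (E : two_idempotent B) (S T : splitting E) :
  equivalent (sp_ob S) (sp_ob T).
Proof.
(* Evaluating the bridge at the identity gives an idempotent 2-morphism on f'∘(g∘1), to which local
   completeness applies. *)
have [h [r [s [sr rs]]]] :=
  HB _ _ _ _ (bridge_idem (splitting_comparison S T _) (id1 _)).
have [k [r' [s' [sr' rs']]]] :=
  HB _ _ _ _ (bridge_idem (splitting_comparison T S _) (id1 _)).
exists h, k; split.
(* The construction is symmetric in [S] and [T], so exchanging them handles [k ∘ h]. *)
- exact: bridge_split_comp sr' rs' sr rs.
- exact: bridge_split_comp sr rs sr' rs'.
Qed.
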